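(* Let $n\ge1$ and let $\Gamma$ be a generalized dissection of $S(A_n)$. Then each tile of $\Gamma$ is a triangle.
   Context: The surface $S(A_n)$ (associated with the path algebra $A_n$ of the quiver $1\to2\to\cdots\to n$) is a closed disk with $n+3$ points on its boundary, in counterclockwise order $p,x_0,x_1,\dots,x_n,x_{n+1}$. The points $p,x_1,\dots,x_n$ are the marked points and $x_0,x_{n+1}$ are the two extra marked points. Permissible curves in $S(A_n)$ (up to equivalence) are the curves joining two of these $n+3$ points, taken up to isotopy fixing endpoints and with minimal intersection; there is one for each pair of distinct points. A boundary segment is a segment of the boundary circle between two consecutive points among the $n+3$ points. A partial generalized dissection is a set of permissible curves, none homotopic to a boundary segment, any two of which do not meet in the interior of the disk; a generalized dissection is a maximal partial generalized dissection. A tile of $\Gamma$ is a polygon obtained by cutting the disk along $\Gamma$; its edges are curves of $\Gamma$ and boundary segments (extra marked points lying on the boundary of a tile count as vertices of the tile). *)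

(* Defs.v *)
From HB Require Import structures.
From mathcomp Require Import all_boot all_order all_algebra.
From mathcomp Require Import all_classical all_reals all_analysis.

Set Implicit Arguments.
Unset Strict Implicit.
Unset Printing Implicit Defensive.

Import Order.TTheory GRing.Theory Num.Theory.
Import numFieldNormedType.Exports.

Local Open Scope classical_set_scope.
Local Open Scope ring_scope.

(* The surface S(A_n) is the closed unit disk of the plane
   R * R. Its n + 3 boundary points p, x_0, x_1, ..., x_n, x_(n+1) are indexed,
   in this order, by 'I_n.+3: p has index 0 and x_k has index k + 1. *)

Definition disk (R : realType) : set (R * R) :=
  [set z | z.1 ^+ 2 + z.2 ^+ 2 <= 1].

Definition open_disk (R : realType) : set (R * R) :=
  [set z | z.1 ^+ 2 + z.2 ^+ 2 < 1].

Definition circ (R : realType) (t : R) : R * R := (cos t, sin t).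

(* The points circ (theta i) are distinct and in counterclockwise order. *)
Definition ccw_angles (R : realType) (n : nat) (theta : 'I_n.+3 -> R) : Prop :=
  (forall i j : 'I_n.+3, (i < j)%N -> theta i < theta j) /\
  theta ord_max < theta ord0 + 2 * pi.

Definition pt (R : realType) (n : nat) (theta : 'I_n.+3 -> R) (i : 'I_n.+3) :
    R * R := circ (theta i).

(* An isotopy class of curves is determined by its two distinct endpoints, so
   a permissible curve is a two-element set of indices. Its representative is
   the straight chord; chords are simultaneously in minimal position. *)
Definition permissible (n : nat) (g : {set 'I_n.+3}) : Prop := #|g| = 2%N.

Definition chord_path (R : realType) (n : nat) (theta : 'I_n.+3 -> R)
    (i j : 'I_n.+3) (t : R) : R * R :=
  (1 - t) *: pt theta i + t *: pt theta j.

Definition chord (R : realType) (n : nat) (theta : 'I_n.+3 -> R)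
    (g : {set 'I_n.+3}) : set (R * R) :=
  [set z | exists i j : 'I_n.+3,
     g = [set i; j]%SET /\ (chord_path theta i j @` `[0, 1]) z].

(* The boundary segment number i goes counterclockwise from the point i to
   the point ordS i, the cyclic successor. *)
Definition next_angle (R : realType) (n : nat) (theta : 'I_n.+3 -> R)
    (i : 'I_n.+3) : R :=
  if i == ord_max then theta ord0 + 2 * pi else theta (ordS i).

Definition arc_path (R : realType) (n : nat) (theta : 'I_n.+3 -> R)
    (i : 'I_n.+3) (t : R) : R * R :=
  circ ((1 - t) * theta i + t * next_angle theta i).

Definition boundary_segment (R : realType) (n : nat) (theta : 'I_n.+3 -> R)
    (i : 'I_n.+3) : set (R * R) :=
  arc_path theta i @` `[0, 1].

(* Homotopy in the disk of paths parametrized by [0, 1], endpoints fixed. *)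
Definition path_homotopic (R : realType) (f g : R -> R * R) : Prop :=
  exists H : R * R -> R * R,
    [/\ {within `[0, 1] `*` `[0, 1], continuous H},
        H @` (`[0, 1] `*` `[0, 1]) `<=` @disk R,
        forall t, t \in `[0, 1] -> H (0, t) = f t /\ H (1, t) = g t &
        forall s, s \in `[0, 1] -> H (s, 0) = f 0 /\ H (s, 1) = f 1].

Definition homotopic_to_boundary (R : realType) (n : nat)
    (theta : 'I_n.+3 -> R) (g : {set 'I_n.+3}) : Prop :=
  exists i j k : 'I_n.+3,
    g = [set i; j]%SET /\
    path_homotopic (chord_path theta i j) (arc_path theta k).

Definition partial_generalized_dissection (R : realType) (n : nat)
    (theta : 'I_n.+3 -> R) (G : {set {set 'I_n.+3}}) : Prop :=
  [/\ forall g, g \in G -> permissible g,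
      forall g, g \in G -> ~ homotopic_to_boundary theta g &
      forall g h, g \in G -> h \in G -> g <> h ->
        chord theta g `&` chord theta h `&` @open_disk R = set0].

Definition generalized_dissection (R : realType) (n : nat)
    (theta : 'I_n.+3 -> R) (G : {set {set 'I_n.+3}}) : Prop :=
  partial_generalized_dissection theta G /\
  forall G' : {set {set 'I_n.+3}},
    partial_generalized_dissection theta G' -> G \subset G' -> G' = G.

Definition cut_disk (R : realType) (n : nat) (theta : 'I_n.+3 -> R)
    (G : {set {set 'I_n.+3}}) : set (R * R) :=
  @disk R `\` \bigcup_(g in [set` G]) chord theta g.

Definition is_tile (R : realType) (n : nat) (theta : 'I_n.+3 -> R)
    (G : {set {set 'I_n.+3}}) (T : set (R * R)) : Prop :=
  exists2 z, cut_disk theta G z &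
    T = closure (connected_component (cut_disk theta G) z).

Definition tile_vertices (R : realType) (n : nat) (theta : 'I_n.+3 -> R)
    (T : set (R * R)) : {set 'I_n.+3} :=
  [set i | `[< T (pt theta i) >]]%SET.

Definition tile_curve_edges (R : realType) (n : nat) (theta : 'I_n.+3 -> R)
    (G : {set {set 'I_n.+3}}) (T : set (R * R)) : {set {set 'I_n.+3}} :=
  [set g in G | `[< chord theta g `<=` T >]]%SET.

Definition tile_boundary_edges (R : realType) (n : nat) (theta : 'I_n.+3 -> R)
    (T : set (R * R)) : {set {set 'I_n.+3}} :=
  [set [set i; ordS i] | i : 'I_n.+3 & `[< boundary_segment theta i `<=` T >]]%SET.

(* Edges are recorded by their endpoints; this loses nothing, as a curve of a
   dissection never has the same endpoints as a boundary segment. *)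
Definition tile_edges (R : realType) (n : nat) (theta : 'I_n.+3 -> R)
    (G : {set {set 'I_n.+3}}) (T : set (R * R)) : {set {set 'I_n.+3}} :=
  (tile_curve_edges theta G T :|: tile_boundary_edges theta T)%SET.

Definition is_triangle (R : realType) (n : nat) (theta : 'I_n.+3 -> R)
    (G : {set {set 'I_n.+3}}) (T : set (R * R)) : Prop :=
  exists a b c : 'I_n.+3,
    [/\ uniq [:: a; b; c],
        tile_vertices theta T = [set a; b; c]%SET &
        tile_edges theta G T = [set [set a; b]; [set b; c]; [set a; c]]%SET].

(* Main.v *)
Require Import Defs.
From HB Require Import structures.
From mathcomp Require Import all_boot all_order all_algebra.
From mathcomp Require Import all_classical all_reals all_analysis.
From mathcomp Require Import ring lra zify.

Set Implicit Arguments.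
Unset Strict Implicit.
Unset Printing Implicit Defensive.

Import Order.TTheory GRing.Theory Num.Theory.
Import numFieldNormedType.Exports.

Local Open Scope classical_set_scope.
Local Open Scope ring_scope.

(** Cut the disk along straight chords. The chord from A to B is the
    intersection of the disk with the zero set of the affine function
    [orient A B], so the cut disk consists of the points of the disk where none
    of these functions vanishes. The component of a point z is convex: it is
    where every [orient A B] has the same sign as at z. Its closure, the tile of
    z, is described by the corresponding weak inequalities
    ([connected_component_off_lines], [closure_open_cell]). For three points of
    the circle the sign of [orient] is that of a product of sines and only
    depends on the cyclic order ([orient_circ]), so that the sides of the chords
    can be compared by comparing indices.

    Call vertices of a tile the marked points that it contains.

    There are at least three ([tile_has_three_vertices]). Among the chords
    {a, b}, a < b, which have z in the cap cut off by them on the side of the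
    arc from a to b, take the one with b - a minimal; if there is none, take the
    first and the last point. Let c be the last point before b that is joined
    to a by a chord, or a + 1 if there is none. No chord separates a, b or c
    from z: another chord with ends between a and b (inclusive) has z on its
    outer side by minimality, and c too by the choice of c; any other chord has
    no end strictly between a and b, so it does not enter the cap of {a, b},
    which holds z and c ([cap_same_side]).

    Two vertices are joined by a chord of the dissection or by a boundary
    segment ([tile_vertices_joined]): the tile lies on one side of every chord,
    so the segment between two vertices crosses none, and unless it
    is homotopic to a boundary segment it can be added; by maximality it is
    there. The chord or boundary segment that joins two vertices lies in the
    tile ([chord_sub_tile], [boundary_segment_sub_tile]).

    There are at most three ([no_four_vertices]): with four vertices
    a < b < c < d the points a and c are not neighbours on the circle, so
    {a, c} is a chord of the dissection; but it separates b from d.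

    Hence a tile has three vertices and its edges are the three pairs of them. *)

(** * Orientation and segments in the disk *)

(** Twice the signed area of the triangle a, b, w: positive when w is to the left
    of the line directed from a to b, zero on that line, and affine in w. *)
Definition orient (R : realType) (a b w : R * R) : R :=
  (b.1 - a.1) * (w.2 - a.2) - (b.2 - a.2) * (w.1 - a.1).

Definition segpt (R : realType) (a b : R * R) (t : R) : R * R :=
  (1 - t) *: a + t *: b.

Lemma segpt1 (R : realType) (a b : R * R) (t : R) :
  (segpt a b t).1 = (1 - t) * a.1 + t * b.1.
Proof. by []. Qed.

Lemma segpt2 (R : realType) (a b : R * R) (t : R) :
  (segpt a b t).2 = (1 - t) * a.2 + t * b.2.
Proof. by []. Qed.

Lemma segpt_0 (R : realType) (a b : R * R) : segpt a b 0 = a.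
Proof. by rewrite /segpt subr0 scale1r scale0r addr0. Qed.

Lemma segpt_1 (R : realType) (a b : R * R) : segpt a b 1 = b.
Proof. by rewrite /segpt subrr scale1r scale0r add0r. Qed.

Lemma orient_segpt (R : realType) (a b u v : R * R) (t : R) :
  orient a b (segpt u v t) = (1 - t) * orient a b u + t * orient a b v.
Proof. by rewrite /orient segpt1 segpt2; ring. Qed.

Lemma orientl (R : realType) (a b : R * R) : orient a b a = 0.
Proof. by rewrite /orient; ring. Qed.

Lemma orientr (R : realType) (a b : R * R) : orient a b b = 0.
Proof. by rewrite /orient; ring. Qed.

Lemma normsq_segpt (R : realType) (u v : R * R) (t : R) :
  (segpt u v t).1 ^+ 2 + (segpt u v t).2 ^+ 2 =
  (1 - t) * (u.1 ^+ 2 + u.2 ^+ 2) + t * (v.1 ^+ 2 + v.2 ^+ 2)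
  - t * (1 - t) * ((v.1 - u.1) ^+ 2 + (v.2 - u.2) ^+ 2).
Proof. by rewrite segpt1 segpt2; ring. Qed.

Lemma disk_segpt (R : realType) (u v : R * R) (t : R) :
  0 <= t <= 1 -> disk u -> disk v -> disk (segpt u v t).
Proof.
move=> /andP[t0 t1]; rewrite /disk /= => du dv; rewrite normsq_segpt.
have h1 : (1 - t) * (u.1 ^+ 2 + u.2 ^+ 2) <= 1 - t.
  by rewrite ler_piMr // subr_ge0.
have h2 : t * (v.1 ^+ 2 + v.2 ^+ 2) <= t by rewrite ler_piMr.
have h3 : 0 <= t * (1 - t) * ((v.1 - u.1) ^+ 2 + (v.2 - u.2) ^+ 2).
  by rewrite !mulr_ge0 ?subr_ge0 // addr_ge0 // sqr_ge0.
lra.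
Qed.

Lemma sqdist_gt0 (R : realType) (a b : R * R) :
  a != b -> 0 < (b.1 - a.1) ^+ 2 + (b.2 - a.2) ^+ 2.
Proof.
move=> ab; rewrite lt0r addr_ge0 ?sqr_ge0 // andbT paddr_eq0 ?sqr_ge0 //.
rewrite !sqrf_eq0 !subr_eq0; apply: contra ab => /andP[/eqP e1 /eqP e2].
by case: (a) (b) e1 e2 => [? ?] [? ?] /= -> ->.
Qed.

(** The parameter t of w on the line satisfies |w|^2 = 1 - t (1 - t) |b - a|^2,
    which exceeds 1 unless t is in [0, 1]. *)
Lemma line_disk_segpt (R : realType) (a b w : R * R) :
  a.1 ^+ 2 + a.2 ^+ 2 = 1 -> b.1 ^+ 2 + b.2 ^+ 2 = 1 -> a != b ->
  disk w -> orient a b w = 0 -> exists2 t, 0 <= t <= 1 & w = segpt a b t.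
Proof.
move=> na nb ab dw ow.
pose D := (b.1 - a.1) ^+ 2 + (b.2 - a.2) ^+ 2.
have D0 : 0 < D by exact: sqdist_gt0.
(* t is the parameter of the orthogonal projection of w to the line. *)
pose t := ((w.1 - a.1) * (b.1 - a.1) + (w.2 - a.2) * (b.2 - a.2)) / D.
have wE : w = segpt a b t.
  have Dn : D != 0 by rewrite gt_eqF.
  have e1 : (segpt a b t).1 = w.1.
    rewrite segpt1; apply: (mulfI Dn); rewrite /t.
    transitivity (D * a.1 + ((w.1 - a.1) * (b.1 - a.1)
      + (w.2 - a.2) * (b.2 - a.2)) * (b.1 - a.1)); first by field.
    apply/eqP; rewrite -subr_eq0; apply/eqP.
    transitivity ((b.2 - a.2) * orient a b w); last by rewrite ow mulr0.
    by rewrite /D /orient; ring.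
  have e2 : (segpt a b t).2 = w.2.
    rewrite segpt2; apply: (mulfI Dn); rewrite /t.
    transitivity (D * a.2 + ((w.1 - a.1) * (b.1 - a.1)
      + (w.2 - a.2) * (b.2 - a.2)) * (b.2 - a.2)); first by field.
    apply/eqP; rewrite -subr_eq0; apply/eqP.
    transitivity (- (b.1 - a.1) * orient a b w); last by rewrite ow mulr0.
    by rewrite /D /orient; ring.
  by move: e1 e2; case: (segpt a b t) (w) => [? ?] [? ?] /= -> ->.
exists t => //; move: dw; rewrite /disk /= wE normsq_segpt na nb -/D => h.
have : 0 <= t * (1 - t).
  by rewrite -(pmulr_lge0 _ D0); lra.
move: (t) => s hs; apply/andP; split; nra.
Qed.

Lemma open_disk_segpt (R : realType) (u v : R * R) (t : R) :
  u.1 ^+ 2 + u.2 ^+ 2 = 1 -> v.1 ^+ 2 + v.2 ^+ 2 = 1 -> u != v ->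
  0 < t < 1 -> open_disk (segpt u v t).
Proof.
move=> nu nv uv /andP[t0 t1]; rewrite /open_disk /= normsq_segpt nu nv.
have D0 := sqdist_gt0 uv.
have : 0 < t * (1 - t) * ((v.1 - u.1) ^+ 2 + (v.2 - u.2) ^+ 2).
  by rewrite !mulr_gt0 // subr_gt0.
lra.
Qed.

(** Intermediate value theorem for an affine function on [0, 1]. *)
Lemma opposite_sign_zero (R : realType) (x y : R) : x * y <= 0 ->
  exists2 t, 0 <= t <= 1 & (1 - t) * x + t * y = 0.
Proof.
move=> xy; have [e|ne] := eqVneq (x - y) 0.
  by exists 0; [rewrite lexx ler01 | nra].
exists (x / (x - y)); last by field.
case: (ltP 0 (x - y)) => h.
  rewrite ler_pdivlMr // ler_pdivrMr // mul0r mul1r; apply/andP; split; nra.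
have {}h : x - y < 0 by rewrite lt_neqAle ne.
rewrite ler_ndivlMr // ler_ndivrMr // mul0r mul1r; apply/andP; split; nra.
Qed.

(** If the chord from u to v has its ends on the side of [orient a b] opposite to
    the cap [orient a b < 0], it cannot separate two points z, m of this cap:
    otherwise the segment from z to m, which stays in the cap, would meet the
    line through u and v in a point of the disk, hence in a point of the chord,
    where [orient a b] is nonnegative. *)
Lemma cap_same_side (R : realType) (a b u v z m : R * R) :
  u.1 ^+ 2 + u.2 ^+ 2 = 1 -> v.1 ^+ 2 + v.2 ^+ 2 = 1 -> u != v ->
  0 <= orient a b u -> 0 <= orient a b v ->
  disk z -> disk m -> orient a b z < 0 -> orient a b m < 0 ->
  0 < orient u v z * orient u v m.
Proof.
move=> nu nv uv au av dz dm az am; rewrite ltNge; apply/negP.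
move=> /opposite_sign_zero[t /andP[t0 t1]]; rewrite -orient_segpt => ow.
have dw : disk (segpt z m t) by apply: disk_segpt => //; rewrite t0.
have [s /andP[s0 s1] ws] := line_disk_segpt nu nv uv dw ow.
have := orient_segpt a b z m t; rewrite ws orient_segpt => E.
have : 0 <= (1 - s) * orient a b u + s * orient a b v.
  by rewrite addr_ge0 // mulr_ge0 // subr_ge0.
rewrite E; move: (orient a b z) (orient a b m) az am => x y hx hy.
nra.
Qed.

(** * Orientation on the circle *)

Lemma circ_norm (R : realType) (x : R) : (circ x).1 ^+ 2 + (circ x).2 ^+ 2 = 1.
Proof. exact: cos2Dsin2. Qed.

Lemma circ_disk (R : realType) (x : R) : disk (circ x).
Proof. by rewrite /disk /= circ_norm. Qed.

(** Expanding the determinant gives sin (y - x) + sin (p - y) - sin (p - x),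
    which factors by the double angle formulas. The half angles lie in [0, pi]
    when x, y, p are in this order within one turn, and there the sine is
    nonnegative. *)
Lemma orient_circ (R : realType) (x y p : R) :
  orient (circ x) (circ y) (circ p) =
  4 * (sin ((y - x) / 2) * (sin ((p - x) / 2) * sin ((p - y) / 2))).
Proof.
pose u := (y - x) / 2; pose v := (p - y) / 2.
have -> : orient (circ x) (circ y) (circ p) =
    sin (y - x) + sin (p - y) - sin (p - x).
  by rewrite /orient /circ /= !sinB; ring.
have -> : y - x = u + u by rewrite /u; lra.
have -> : p - y = v + v by rewrite /v; lra.
have -> : p - x = (u + v) + (u + v) by rewrite /u /v; lra.
have -> : (u + u) / 2 = u by lra.
have -> : (v + v) / 2 = v by lra.
have -> : (u + v + (u + v)) / 2 = u + v by lra.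
rewrite !(sinD, cosD).
have hu := cos2Dsin2 u; have hv := cos2Dsin2 v.
transitivity (2 * sin u * cos u * ((cos v ^+ 2 + sin v ^+ 2) - cos v ^+ 2 + sin v ^+ 2)
  + 2 * sin v * cos v * ((cos u ^+ 2 + sin u ^+ 2) - cos u ^+ 2 + sin u ^+ 2)).
  by rewrite hu hv; ring.
by ring.
Qed.

Lemma orient_circ_gt0 (R : realType) (x y p : R) :
  x < y -> y < p -> p < x + 2 * pi -> 0 < orient (circ x) (circ y) (circ p).
Proof.
move=> xy yp px; rewrite orient_circ.
by rewrite !mulr_gt0 ?sin_gt0_pi //; apply/andP; split; lra.
Qed.

Lemma orient_circ_ge0 (R : realType) (x y p : R) :
  x <= y -> y <= p -> p <= x + 2 * pi -> 0 <= orient (circ x) (circ y) (circ p).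
Proof.
move=> xy yp px; rewrite orient_circ.
by rewrite !mulr_ge0 ?sin_ge0_pi //; apply/andP; split; lra.
Qed.

Lemma orient_rot (R : realType) (a b c : R * R) : orient a b c = orient b c a.
Proof. by rewrite /orient; ring. Qed.

Lemma orientC (R : realType) (a b c : R * R) : orient a b c = - orient b a c.
Proof. by rewrite /orient; ring. Qed.

Lemma orient_circ_inside (R : realType) (x y p : R) :
  x <= p <= y -> y <= x + 2 * pi -> orient (circ x) (circ y) (circ p) <= 0.
Proof.
move=> /andP[xp py] yx; rewrite orientC oppr_le0 orient_rot.
exact: orient_circ_ge0.
Qed.

Lemma circ_2pi (R : realType) (x : R) : circ (x + 2 * pi) = circ x.
Proof. by rewrite /circ mulr_natl cosD2pi sinD2pi. Qed.

(** * Cells cut out of the disk by lines *)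

Lemma continuous_orient (R : realType) (a b : R * R) : continuous (orient a b).
Proof.
move=> w; rewrite /orient.
apply: cvgB; (apply: cvgM; first exact: cvg_cst);
  (apply: cvgB; last exact: cvg_cst); [exact: cvg_snd|exact: cvg_fst].
Qed.

Lemma continuous_segpt (R : realType) (a b : R * R) : continuous (segpt a b).
Proof.
move=> t; apply: cvgD; apply: cvgZ; try exact: cvg_cst.
- by apply: cvgB; [exact: cvg_cst|exact: cvg_id].
- exact: cvg_id.
Qed.

Lemma closed_disk (R : realType) : closed (@disk R).
Proof.
have -> : @disk R = (fun z : R * R => z.1 ^+ 2 + z.2 ^+ 2) @^-1` [set x | x <= 1].
  by [].
apply: preimage_closed; last exact: closed_le.
by move=> w _; apply: cvgD; apply: cvgM; (exact: cvg_fst || exact: cvg_snd).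
Qed.

(** The image of a connected set is an interval, which contains 0 as soon as it
    contains numbers of both signs. *)
Lemma connected_sign (R : realType) (T : topologicalType) (f : T -> R)
    (B : set T) (x y : T) :
  continuous f -> connected B -> B x -> B y -> (forall z, B z -> f z != 0) ->
  0 < f x * f y.
Proof.
move=> cf cB Bx By fB.
have := connected_continuous_connected cB (continuous_subspaceT cf).
move=> /connected_intervalP itvf.
have no0 : ~ (f @` B) 0 by move=> [z /fB + fz]; rewrite fz eqxx.
have [fx fy] := (fB _ Bx, fB _ By).
have ix : (f @` B) (f x) by exists x.
have iy : (f @` B) (f y) by exists y.
case: (ltgtP (f x) 0) fx => // hx _; case: (ltgtP (f y) 0) fy => // hy _.
- by rewrite nmulr_lgt0.
- by case: no0; apply: (itvf _ _ ix iy); rewrite !ltW.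
- by case: no0; apply: (itvf _ _ iy ix); rewrite !ltW.
- exact: mulr_gt0.
Qed.

(** The lines are indexed by D; line i passes through [a i] and [b i]. *)
Definition off_lines (R : realType) (I : Type) (D : set I) (a b : I -> R * R) :
    set (R * R) :=
  @disk R `&` [set w | forall i, D i -> orient (a i) (b i) w != 0].

(** The conditions [0 < orient w * orient z] say that w and z are strictly on the
    same side of each line. *)
Definition open_cell (R : realType) (I : Type) (D : set I) (a b : I -> R * R)
    (z : R * R) : set (R * R) :=
  @disk R `&`
  [set w | forall i, D i -> 0 < orient (a i) (b i) w * orient (a i) (b i) z].

Definition closed_cell (R : realType) (I : Type) (D : set I) (a b : I -> R * R)
    (z : R * R) : set (R * R) :=
  @disk R `&`
  [set w | forall i, D i -> 0 <= orient (a i) (b i) w * orient (a i) (b i) z].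

(** The cell is convex, hence connected; conversely no [orient] changes sign on
    a connected set that avoids all the lines. *)
Lemma connected_component_off_lines (R : realType) (I : Type) (D : set I)
    (a b : I -> R * R) (z : R * R) :
  off_lines D a b z ->
  connected_component (off_lines D a b) z = open_cell D a b z.
Proof.
move=> Az; apply/seteqP; split=> w.
- move=> [B [Bz BA cB] Bw]; split=> [|i Di /=]; first by have [] := BA _ Bw.
  apply: (connected_sign (@continuous_orient _ (a i) (b i)) cB Bw Bz).
  by move=> u /BA[_]; exact.
- move=> [dw sw]; exists (segpt w z @` `[0, 1]); last first.
    by exists 0; rewrite ?segpt_0 //= in_itv /= lexx ler01.
  split.
  + by exists 1; rewrite ?segpt_1 //= in_itv /= lexx ler01.
  + move=> _ [t + <-]; rewrite /= in_itv /= => t01; split.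
      by apply: disk_segpt => //; have [] := Az.
    move=> i Di /=; rewrite orient_segpt.
    have {sw} /= := sw i Di; have [_ /(_ i Di) /=] := Az.
    move: (orient _ _ w) (orient _ _ z) => x y y0 xy; move/andP: t01 => [t0 t1].
    apply/eqP => e.
    have : (1 - t) * (x * y) + t * (y * y) = 0.
      by transitivity (((1 - t) * x + t * y) * y); [ring|rewrite e mul0r].
    have y2 : 0 < y * y by rewrite -expr2 exprn_even_gt0.
    have : 0 <= (1 - t) * (x * y) by rewrite mulr_ge0 ?subr_ge0 // ltW.
    have : 0 <= t * (y * y) by rewrite mulr_ge0 // ltW.
    nra.
  + apply: connected_continuous_connected; first exact: segment_connected.
    exact/continuous_subspaceT/continuous_segpt.
Qed.

Lemma closed_closed_cell (R : realType) (I : Type) (D : set I)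
    (a b : I -> R * R) (z : R * R) : closed (closed_cell D a b z).
Proof.
apply: closedI; first exact: closed_disk.
have -> : [set w | forall i, D i -> 0 <= orient (a i) (b i) w * orient (a i) (b i) z]
  = \bigcap_(i in D)
      ((fun w => orient (a i) (b i) w * orient (a i) (b i) z) @^-1` [set x | 0 <= x]).
  by [].
apply: closed_bigI => i _; apply: preimage_closed; last exact: closed_ge.
by move=> w _; apply: cvgM; [exact: continuous_orient|exact: cvg_cst].
Qed.

(** Points (1 - t) w + t z with t > 0 small lie strictly inside the cell when w
    satisfies the weak inequalities, since z satisfies the strict ones. *)
Lemma closure_open_cell (R : realType) (I : Type) (D : set I)
    (a b : I -> R * R) (z : R * R) :
  off_lines D a b z -> closure (open_cell D a b z) = closed_cell D a b z.
Proof.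
move=> [dz oz]; apply/seteqP; split.
- rewrite [X in _ `<=` X](closure_id _).1; last exact: closed_closed_cell.
  apply: closureS.
  by move=> w [dw h]; split=> // i Di; exact/ltW/h.
- move=> w [dw h] B /= nB.
  have : nbhs (0 : R) (segpt w z @^-1` B).
    by apply: (@continuous_segpt _ w z); rewrite segpt_0.
  move=> /nbhs_ballP[e /= e0 eB].
  pose t := Num.min 1 (e / 2).
  have t0 : 0 < t by rewrite lt_min ltr01 divr_gt0.
  have t1 : t <= 1 by rewrite ge_min lexx.
  exists (segpt w z t); split; last first.
    apply: eB; rewrite /ball /= sub0r normrN gtr0_norm //.
    by rewrite gt_min ltr_pdivrMr // ltr_pMr // ltr1n orbT.
  split; first by apply: disk_segpt => //; rewrite (ltW t0).
  move=> i Di /=; rewrite orient_segpt; have /= := h i Di; have /= := oz i Di.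
  move: (orient _ _ w) (orient _ _ z) => x y y0 xy.
  have y2 : 0 < y * y by rewrite -expr2 exprn_even_gt0.
  have : 0 <= (1 - t) * (x * y) by rewrite mulr_ge0 // subr_ge0.
  have : 0 < t * (y * y) by rewrite mulr_gt0.
  lra.
Qed.

(** * Pairs of indices *)

Definition consecutive (n : nat) (g : {set 'I_n.+3}) :=
  exists k, g = [set k; ordS k]%SET.

Lemma ordSE (n : nat) (k : 'I_n.+3) :
  ordS k = (if k == ord_max then 0 else k.+1)%N :> nat.
Proof.
rewrite /=; case: eqP => [->|/eqP]; first by rewrite /= modnn.
by rewrite -val_eqE /= => h; rewrite modn_small //; have := ltn_ord k; lia.
Qed.

Lemma ordS_max (n : nat) : ordS (@ord_max n.+2) = ord0.
Proof. by apply: ord_inj; rewrite ordSE eqxx. Qed.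

(** A pair of indices has only one increasing enumeration, so the statements
    below parametrize chords by d < e. *)
Lemma eq_set2_lt (n : nat) (a b d e : 'I_n.+3) : (a < b)%N -> (d < e)%N ->
  [set a; b]%SET = [set d; e]%SET -> a = d /\ b = e.
Proof.
move=> ab de /setP E.
have := E a; have := E b; have := E d; have := E e; rewrite !inE !eqxx ?orbT /=.
rewrite -!val_eqE /= => h1 h2 h3 h4.
by split; apply: val_inj => /=; lia.
Qed.

Lemma consecutiveE (n : nat) (a b : 'I_n.+3) : (a < b)%N ->
  consecutive [set a; b]%SET <->
  b = a.+1 :> nat \/ (a = 0 :> nat /\ b = n.+2 :> nat).
Proof.
move=> ab; split.
  move=> [k]; have := ordSE k; case: eqP => [->|/eqP kM] oS.
    have lt : (ordS (@ord_max n.+2) < @ord_max n.+2)%N by rewrite oS.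
    by rewrite [RHS]finset.setUC => /(eq_set2_lt ab lt)[-> ->]; right.
  have lt : (k < ordS k)%N by rewrite oS.
  by move=> /(eq_set2_lt ab lt)[-> ->]; left.
move=> [bE|[a0 bM]].
  exists a; congr [set _; _]%SET; apply: ord_inj; rewrite ordSE; case: eqP => // aM.
  by have := ltn_ord b; rewrite bE aM /= ltnn.
exists b; rewrite [LHS]finset.setUC; congr [set _; _]%SET; apply: ord_inj; rewrite ordSE.
by rewrite -val_eqE /= bM eqxx a0.
Qed.

Lemma permissible_lt (n : nat) (g : {set 'I_n.+3}) : permissible g ->
  exists d e : 'I_n.+3, (d < e)%N /\ g = [set d; e]%SET.
Proof.
rewrite /permissible => /eqP/cards2P[d [e [de ->]]].
move: de; rewrite -val_eqE neq_ltn => /orP[h|h].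
  by exists d, e.
by exists e, d; rewrite finset.setUC.
Qed.

(** * Sides of chords between marked points *)

Section Tiles.
Context (R : realType) (n : nat) (theta : 'I_n.+3 -> R) (ccw : ccw_angles theta).
Implicit Types (a b c d e i j k : 'I_n.+3) (g h : {set 'I_n.+3}).
Implicit Types (G : {set {set 'I_n.+3}}) (z w : R * R) (T : set (R * R)).

Local Notation side d e := (orient (pt theta d) (pt theta e)).

Lemma theta_le i j : (i <= j)%N -> theta i <= theta j.
Proof.
by rewrite leq_eqVlt => /orP[/eqP/val_inj ->//|/ccw.1/ltW].
Qed.

Lemma theta_lt2pi i j : theta j < theta i + 2 * pi.
Proof.
apply: (le_lt_trans (@theta_le j ord_max _)); first by rewrite -ltnS ltn_ord.
by apply: (lt_le_trans ccw.2); rewrite lerD2r; apply: theta_le.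
Qed.

Lemma side_gt0 d i e : (d < i < e)%N -> 0 < side d i (pt theta e).
Proof.
move=> /andP[di ie]; apply: orient_circ_gt0 (theta_lt2pi _ _); exact: ccw.1.
Qed.

Lemma side_inside d e i : (d < i < e)%N -> side d e (pt theta i) < 0.
Proof.
by move=> /side_gt0; rewrite orientC orient_rot oppr_gt0.
Qed.

Lemma side_outside d e i : (d < e)%N -> (i < d)%N || (e < i)%N ->
  0 < side d e (pt theta i).
Proof.
move=> de /orP[id|ei]; last by apply: side_gt0; rewrite de.
by rewrite -orient_rot; apply: side_gt0; rewrite id.
Qed.

Lemma side_eq0 d e i : (d < e)%N ->
  side d e (pt theta i) = 0 -> i = d \/ i = e.
Proof.
move=> de; case: (ltngtP i d) => [id|di|/val_inj ->]; last by left.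
  by move=> h; have := @side_outside d e i de; rewrite id h ltxx => /(_ isT).
case: (ltngtP i e) => [ie|ei|/val_inj ->]; last by right.
  by move=> h; have := @side_inside d e i; rewrite di ie h ltxx => /(_ isT).
by move=> h; have := @side_outside d e i de; rewrite ei orbT h ltxx => /(_ isT).
Qed.

Lemma side_inside_le d e i : (d <= i <= e)%N ->
  side d e (pt theta i) <= 0.
Proof.
by move=> /andP[di ie]; apply: orient_circ_inside; rewrite ?theta_le ?ltW ?theta_lt2pi.
Qed.

Lemma side_outside_ge d e i : (d < e)%N -> (i <= d)%N || (e <= i)%N ->
  0 <= side d e (pt theta i).
Proof.
move=> de /orP[]; rewrite leq_eqVlt => /orP[/eqP/val_inj->|h].
- by rewrite orientl.
- by apply/ltW/side_outside; rewrite ?h.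
- by rewrite orientr.
- by apply/ltW/side_outside; rewrite ?h ?orbT.
Qed.

(** If the points i and j coincided, [side i j] would vanish identically, so that
    every index would be i or j; there are at least three. *)
Lemma pt_inj : injective (pt theta).
Proof.
move=> i j; wlog ij : i j / (i < j)%N.
  move=> wl; case: (ltngtP i j) => [ij|ji|/val_inj//] e; first exact: wl.
  by apply/esym/wl.
move=> e.
have h k : k = i \/ k = j by apply: side_eq0 => //; rewrite e /orient; ring.
have h1 := h (Ordinal (isT : 1 < n.+3)%N).
by case: (h ord0) => /(congr1 val) /=; case: (h ord_max) => /(congr1 val) /=;
  case: h1 => /(congr1 val) /=; move: ij; clear; lia.
Qed.

Lemma pt_neq i j : (i < j)%N -> pt theta i != pt theta j.
Proof. by move=> ij; apply/eqP => /pt_inj E; rewrite E ltnn in ij. Qed.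

Lemma pt_norm i : (pt theta i).1 ^+ 2 + (pt theta i).2 ^+ 2 = 1.
Proof. exact: circ_norm. Qed.

Lemma pt_disk i : disk (pt theta i).
Proof. exact: circ_disk. Qed.

Lemma chord_pathE i j (t : R) :
  chord_path theta i j t = segpt (pt theta i) (pt theta j) t.
Proof. by []. Qed.

Lemma chordE d e : (d < e)%N -> chord theta [set d; e]%SET =
  @disk R `&` [set w | side d e w = 0].
Proof.
move=> de; apply/seteqP; split=> w.
  move=> [i [j [E [t /= + <-]]]]; rewrite in_itv /= => t01.
  split; first exact: disk_segpt t01 (pt_disk i) (pt_disk j).
  have end0 k : k \in [set d; e]%SET -> side d e (pt theta k) = 0.
    by rewrite !inE => /orP[]/eqP->; rewrite ?orientl ?orientr.
  by rewrite chord_pathE /= orient_segpt !end0 ?E ?set21 ?set22 // !mulr0 addr0.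
move=> [dw /= ow]; exists d, e; split=> //.
have [t t01 ->] := line_disk_segpt (pt_norm d) (pt_norm e) (pt_neq de) dw ow.
by exists t => //=; rewrite in_itv.
Qed.

(** * Boundary arcs *)

Lemma circ_next_angle k : circ (next_angle theta k) = pt theta (ordS k).
Proof. by rewrite /next_angle; case: eqP => // ->; rewrite circ_2pi ordS_max. Qed.

Lemma le_next_angle k : theta k <= next_angle theta k.
Proof.
rewrite /next_angle; case: eqP => [->|/eqP kM]; first exact/ltW/ccw.2.
by apply/ltW/ccw.1; rewrite ordSE (negbTE kM).
Qed.

Lemma arc_path0 k : arc_path theta k 0 = pt theta k.
Proof. by rewrite /arc_path subr0 mul1r mul0r addr0. Qed.

Lemma arc_path1 k : arc_path theta k 1 = pt theta (ordS k).
Proof. by rewrite /arc_path subrr mul1r mul0r add0r circ_next_angle. Qed.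

Lemma continuous_arc_path k : continuous (arc_path theta k).
Proof.
move=> t.
have c : (fun t : R => (1 - t) * theta k + t * next_angle theta k) @ t -->
    (1 - t) * theta k + t * next_angle theta k.
  apply: cvgD; apply: cvgM; try exact: cvg_cst; last exact: cvg_id.
  by apply: cvgB; [exact: cvg_cst|exact: cvg_id].
apply: (cvg_comp _ _ c).
exact: (cvg_pair (@continuous_cos R _) (@continuous_sin R _)).
Qed.

(** Homotopic paths have the same endpoints, and conversely the straight-line
    homotopy stays in the disk by convexity. *)
Lemma homotopic_to_boundaryE g : homotopic_to_boundary theta g <-> consecutive g.
Proof.
have in0 : (0 : R) \in `[0, 1] by rewrite in_itv /= lexx ler01.
have in1 : (1 : R) \in `[0, 1] by rewrite in_itv /= lexx ler01.
split.
  move=> [i [j [k [-> [H [_ _ Ht Hs]]]]]]; exists k.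
  have [_ e0] := Ht _ in0; have [_ e1] := Ht _ in1; have [e2 e3] := Hs _ in1.
  move: e0 e1; rewrite e2 e3 arc_path0 arc_path1 !chord_pathE.
  by rewrite segpt_0 segpt_1 => /pt_inj-> /pt_inj->.
move=> [k ->]; exists k, (ordS k), k; split=> //.
pose C := segpt (pt theta k) (pt theta (ordS k)).
exists (fun st => segpt (C st.2) (arc_path theta k st.2) st.1); split.
- apply: continuous_subspaceT => -[s t].
  have cs : (fun st : R * R => st.1) @ (s, t) --> s by exact: cvg_fst.
  have ct : (fun st : R * R => st.2) @ (s, t) --> t by exact: cvg_snd.
  apply: cvgD; apply: cvgZ => //.
  + by apply: cvgB => //; exact: cvg_cst.
  + by apply: (cvg_comp _ _ ct); exact: continuous_segpt.
  + by apply: (cvg_comp _ _ ct); exact: continuous_arc_path.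
- move=> _ [[s t] /= [+ +] <-]; rewrite !in_itv /= => s01 t01.
  apply: disk_segpt => //; last exact: circ_disk.
  by apply: disk_segpt => //; exact: circ_disk.
- by move=> t _ /=; rewrite segpt_0 segpt_1.
- move=> s _ /=; rewrite /C !segpt_0 !segpt_1 arc_path0 arc_path1 !chord_pathE.
  by rewrite segpt_0 segpt_1 /segpt -!scalerDl subrK !scale1r.
Qed.

(** A boundary arc does not cross a chord between marked points. Both of its ends
    are on the chord only if the chord joins consecutive points; so some end i is
    off the chord, and it tells on which side the whole arc lies. *)
Lemma arc_side d e k (phi : R) :
  (d < e)%N -> ~ consecutive [set d; e]%SET ->
  theta k <= phi <= next_angle theta k ->
  exists2 i, i \in [:: k; ordS k] &
    side d e (pt theta i) != 0 /\
    0 <= side d e (circ phi) * side d e (pt theta i).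
Proof.
move=> de nc /andP[kphi phik].
have {nc} : ~ (e = d.+1 :> nat \/ (d = 0 :> nat /\ e = n.+2 :> nat)).
  by move=> h; apply: nc; apply/(consecutiveE de).
have eM : (e <= n.+2)%N by rewrite -ltnS ltn_ord.
have lt2 := theta_lt2pi.
have le := theta_le.
(* An arc away from the interval from d to e lies on the positive side; shifting
   by a turn brings phi to one of these two ranges. *)
have out i : i \in [:: k; ordS k] -> (i < d)%N || (e < i)%N ->
    (theta e <= phi <= theta d + 2 * pi) \/ (theta e - 2 * pi <= phi <= theta d) ->
    exists2 i, i \in [:: k; ordS k] &
    side d e (pt theta i) != 0 /\
    0 <= side d e (circ phi) * side d e (pt theta i).
  move=> ik iout phiout; exists i => //=.
  have gt := side_outside de iout; split; first by rewrite gt_eqF.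
  rewrite mulr_ge0 ?(ltW gt) //.
  case: phiout => /andP[h1 h2]; first exact: orient_circ_ge0 (le _ _ (ltnW de)) h1 h2.
  rewrite -orient_rot; apply: orient_circ_ge0 => //; first by rewrite le // ltnW.
  by move: h1; lra.
move: phik; rewrite /next_angle; case: eqP => [kM|/eqP kM] phik nc.
  have o0 : ordS k = ord0 by rewrite kM ordS_max.
  have ke : theta e <= theta k by rewrite kM; apply: le.
  have d0 : theta ord0 <= theta d by apply: le.
  case: (ltnP e n.+2) => eM2.
    apply: (out k); rewrite ?inE ?eqxx // ?kM /= ?eM2 ?orbT //.
    by left; apply/andP; split; lra.
  apply: (out (ordS k)); rewrite ?inE ?eqxx ?orbT // ?o0 /=; last first.
    by left; apply/andP; split; lra.
  by lia.
have oS : ordS k = k.+1 :> nat by rewrite ordSE (negbTE kM).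
case: (ltnP k d) => kd.
  apply: (out k); rewrite ?inE ?eqxx // ?kd //.
  right; have := lt2 k e; have := le (ordS k) d; rewrite oS => /(_ kd) *.
  by apply/andP; split; lra.
case: (leqP e k) => ek.
  apply: (out (ordS k)); rewrite ?inE ?eqxx ?orbT // ?oS ?ltnS ?ek ?orbT //.
  left; have := lt2 d (ordS k); have := le e k ek => *.
  by apply/andP; split; lra.
(* There remains d <= k < ordS k <= e, where the side is negative. *)
have [i ik /andP[id ie]] : exists2 i, i \in [:: k; ordS k] & (d < i < e)%N.
  case: (ltnP d k) => dk; first by exists k; rewrite ?inE ?eqxx // dk.
  by exists (ordS k); rewrite ?inE ?eqxx ?orbT // oS; lia.
exists i => //=.
have lt : side d e (pt theta i) < 0.
  by apply: side_inside; rewrite ?id.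
split; first by rewrite lt_eqF.
rewrite nmulr_lge0 //; apply: orient_circ_inside; last exact/ltW/lt2.
have := le d k kd; have := le (ordS k) e; rewrite oS => /(_ ek) *.
by apply/andP; split; lra.
Qed.

(** * Tiles of a dissection *)

(** The ends of the first chord are strictly on opposite sides of the second, so
    the first one meets the line of the second at an interior point of the disk. *)
Lemma crossing_chords a d c e : (a < d < c)%N -> (c < e)%N ->
  chord theta [set a; c]%SET `&` chord theta [set d; e]%SET `&` @open_disk R !=set0.
Proof.
move=> /andP[ad dc] ce.
have ac := ltn_trans ad dc; have de := ltn_trans dc ce.
have sa : 0 < side d e (pt theta a) by apply: side_outside; rewrite ?ad.
have sc : side d e (pt theta c) < 0 by apply: side_inside; rewrite ?dc.
have [t /andP[t0 t1]] : exists2 t, 0 <= t <= 1 &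
    (1 - t) * side d e (pt theta a) + t * side d e (pt theta c) = 0.
  by apply: opposite_sign_zero; rewrite mulr_ge0_le0 ?ltW.
rewrite -orient_segpt => sw.
have pac := pt_neq ac.
have dw : disk (segpt (pt theta a) (pt theta c) t).
  by apply: disk_segpt; rewrite ?t0 ?t1 //; exact: pt_disk.
exists (segpt (pt theta a) (pt theta c) t); split.
  split; rewrite chordE //; split=> //=.
  by rewrite orient_segpt orientl orientr !mulr0 addr0.
apply: open_disk_segpt (pt_norm _) (pt_norm _) pac _.
rewrite !lt_neqAle t0 t1 !andbT; apply/andP; split; apply/eqP => E.
  by move: sw sa; rewrite -E segpt_0 => ->; rewrite ltxx.
by move: sw sc; rewrite E segpt_1 => ->; rewrite ltxx.
Qed.

Definition chord_ends G : set ('I_n.+3 * 'I_n.+3) :=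
  [set p : 'I_n.+3 * 'I_n.+3 | (p.1 < p.2)%N /\ [set p.1; p.2]%SET \in G].

(** The closed tile that contains z, for z off the chords. *)
Definition tile_around G z : set (R * R) :=
  closed_cell (chord_ends G) (fun p => pt theta p.1) (fun p => pt theta p.2) z.

Lemma tile_aroundP G z w : tile_around G z w <->
  disk w /\ forall d e, (d < e)%N -> [set d; e]%SET \in G ->
    0 <= side d e w * side d e z.
Proof.
split=> [[dw h]|[dw h]]; split=> //.
  by move=> d e de deG; apply: (h (d, e)).
by move=> [d e] [/= de deG]; exact: h.
Qed.

Definition off_chords G z := disk z /\
  forall d e, (d < e)%N -> [set d; e]%SET \in G -> side d e z != 0.

Lemma is_tileE G T : (forall g, g \in G -> permissible g) ->
  is_tile theta G T -> exists2 z, off_chords G z & T = tile_around G z.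
Proof.
move=> permG [z cz ->].
have cutE : cut_disk theta G = off_lines (chord_ends G)
    (fun p => pt theta p.1) (fun p => pt theta p.2).
  apply/seteqP; split=> w [dw h]; split=> //=.
    move=> [d e] [/= de deG]; apply/eqP => sw; apply: h.
    by exists [set d; e]%SET => //; rewrite chordE.
  move=> [g /= gG gw]; have [d [e [de gE]]] := permissible_lt (permG g gG).
  move: gw; rewrite gE chordE // => -[_ /= /eqP]; apply/negP.
  by apply: (h (d, e)); split=> //=; rewrite -gE.
rewrite cutE in cz *; exists z.
  by case: cz => dz oz; split=> // d e de deG; apply: (oz (d, e)).
by rewrite connected_component_off_lines // closure_open_cell.
Qed.

(** The vertices are the ends of the smallest cap {a, b} around z and the apex c
    of the triangle on it. *)
Lemma tile_has_three_vertices G z :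
  partial_generalized_dissection theta G -> off_chords G z ->
  exists a c b, [/\ (a < c < b)%N, tile_around G z (pt theta a),
    tile_around G z (pt theta c) & tile_around G z (pt theta b)].
Proof.
move=> [_ ncG crG] [dz oz].
have nonconsec d e : (d < e)%N -> [set d; e]%SET \in G ->
    ~ (e = d.+1 :> nat \/ (d = 0 :> nat /\ e = n.+2 :> nat)).
  move=> de deG h; apply: (ncG _ deG); apply/homotopic_to_boundaryE.
  exact/consecutiveE.
have nocross d e d' e' : (d < d' < e)%N -> (e < e')%N ->
    [set d; e]%SET \in G -> [set d'; e']%SET \in G -> False.
  move=> dd' ee' deG deG'; have [w hw] := crossing_chords dd' ee'.
  have : [set d; e]%SET <> [set d'; e']%SET.
    case/andP: dd' => dd' d'e.
    move/(eq_set2_lt (ltn_trans dd' d'e) (ltn_trans d'e ee')) => [E].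
    by rewrite E ltnn in dd'.
  by move/(crG _ _ deG deG') => E; rewrite E in hw.
(* The pair of the first and the last point stands for a cap that is the whole
   disk; it makes the set of candidates nonempty. *)
pose cap (p : 'I_n.+3 * 'I_n.+3) := (p.1 < p.2)%N &&
  ((p.1 == ord0) && (p.2 == ord_max) ||
   ([set p.1; p.2]%SET \in G) && (side p.1 p.2 z < 0)).
have cap0 : cap (ord0, ord_max) by rewrite /cap /= !eqxx.
case: (arg_minnP (fun p : 'I_n.+3 * 'I_n.+3 => (p.2 - p.1)%N) cap0).
move=> -[a b] /andP[/= ab capab] minab.
have {}minab d e : (d < e)%N -> [set d; e]%SET \in G -> (e - d < b - a)%N ->
    0 < side d e z.
  move=> de deG lt; rewrite ltNge; apply/negP => le0.
  have : cap (d, e) by rewrite /cap /= de deG lt_neqAle oz // le0 orbT.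
  by move/minab => /=; rewrite leqNgt lt.
have ab2 : (a.+1 < b)%N.
  case/orP: capab => [/andP[/eqP-> /eqP->]//|/andP[abG _]].
  have := nonconsec _ _ ab abG; lia.
have a1 : (a.+1 < n.+3)%N by apply: ltn_trans ab2 (ltn_ord b).
(* Taking a + 1 as a candidate makes the boundary segment from a possible as the
   side of the triangle; then the maximal one is joined to a. *)
pose apex e := (a < e < b)%N && ((e == a.+1 :> nat) || ([set a; e]%SET \in G)).
have apex0 : apex (Ordinal a1) by rewrite /apex /= ltnSn ab2 eqxx.
case: (arg_maxnP (fun e => val e) apex0) => c /andP[/= acb apexc] maxc.
have /andP[ac cb] := acb.
(* Only {a, b} itself can have c strictly between its ends, among the chords
   with ends in the interval from a to b. *)
have c_free d e : (a <= d)%N -> (d < c < e)%N -> (e <= b)%N ->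
    [set d; e]%SET \in G -> d = a /\ e = b.
  move=> ad /andP[dc ce] eb deG.
  move: ad; rewrite leq_eqVlt => /orP[/eqP/val_inj E|ad].
    split=> //; apply/val_inj/eqP; rewrite eqn_leq eb /= leqNgt; apply/negP => eb'.
    have : apex e by rewrite /apex eb' E (ltn_trans _ ce) // deG orbT.
    by move/maxc => /=; rewrite leqNgt ce.
  case/orP: apexc => [/eqP c1|acG]; first by exfalso; move: dc ad; rewrite c1; lia.
  by case: (nocross a c d e) => //; rewrite ad.
have vertex i : i \in [:: a; c; b] -> tile_around G z (pt theta i).
  move=> iabc; apply/tile_aroundP; split; first exact: pt_disk.
  move=> d e de deG.
  have aib : (a <= i <= b)%N.
    by move: iabc; rewrite !inE => /or3P[]/eqP->; move: ac cb; clear; lia.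
  have [/andP[ad eb]|out] := boolP ((a <= d)%N && (e <= b)%N).
    have [[da eb']|ne] := pselect (d = a /\ e = b).
      case/orP: capab => [/andP[/eqP a0 /eqP bM]|/andP[_ sz]].
        by case: (nonconsec d e de deG); right; rewrite da eb' a0 bM.
      by rewrite mulr_le0 // ?(ltW sz) // da eb' ?side_inside_le ?(ltW sz).
    apply: mulr_ge0; last first.
      apply/ltW/minab => //.
      have : d <> a :> nat \/ e <> b :> nat.
        have [/val_inj dE|] := pselect (d = a :> nat); last by left.
        by right => /val_inj eE; apply: ne.
      by move: de ad eb; clear; lia.
    apply: side_outside_ge => //; move: iabc; rewrite !inE => /or3P[]/eqP->.
    - by rewrite ad.
    - case: (leqP c d) => //= dc; case: (leqP e c) => //= ce.
      by case: ne; apply: c_free; rewrite ?dc.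
    - by rewrite eb orbT.
  (* Now d or e is not between a and b. This excludes the whole disk as cap, so
     {a, b} is a chord, and as {d, e} does not cross it neither d nor e is
     strictly between a and b. *)
  have bM : (b <= n.+2)%N by rewrite -ltnS ltn_ord.
  have eM : (e <= n.+2)%N by rewrite -ltnS ltn_ord.
  case/orP: capab => [/andP[/eqP a0 /eqP bE]|/andP[abG sz]].
    by move: out; rewrite a0 bE /= eM.
  have dout : (d <= a)%N || (b <= d)%N.
    rewrite leqNgt [(b <= d)%N]leqNgt -negb_and; apply/negP => /andP[ad db].
    apply: (nocross a b d e) => //; rewrite ?ad //.
    by move: out; rewrite (ltnW ad) /= -ltnNge.
  have eout : (e <= a)%N || (b <= e)%N.
    rewrite leqNgt [(b <= e)%N]leqNgt -negb_and; apply/negP => /andP[ae eb].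
    apply: (nocross d e a b) => //; rewrite ?ae ?andbT //.
    by move: out; rewrite (ltnW eb) andbT -ltnNge.
  have pde := pt_neq de.
  have := cap_same_side (pt_norm d) (pt_norm e) pde
    (side_outside_ge ab dout) (side_outside_ge ab eout) dz
    (pt_disk c) sz (side_inside acb) => szc.
  (* By szc, z is on the side of {d, e} of c; so are a and b, weakly. *)
  case: (boolP ((d <= a)%N && (b <= e)%N)) => [/andP[da be]|notin].
    have sc : side d e (pt theta c) < 0.
      by apply: side_inside => //; move: da ac cb be; clear; lia.
    have {}sz : side d e z < 0 by move: szc; rewrite nmulr_lgt0.
    rewrite mulr_le0 ?(ltW sz) //; apply: side_inside_le => //.
    by move: da be aib; clear; lia.
  have outi i' : (a <= i' <= b)%N -> (i' <= d)%N || (e <= i')%N.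
    by move: dout eout notin de; clear; lia.
  have : 0 <= side d e (pt theta c).
    by apply: side_outside_ge => //; apply: outi; rewrite (ltnW ac) (ltnW cb).
  move=> sc; have {}sz : 0 < side d e z by move: szc sc; nra.
  by rewrite mulr_ge0 ?(ltW sz) //; apply: side_outside_ge => //; exact: outi.
exists a, c, b; split=> //; apply: vertex; rewrite !inE eqxx ?orbT //.
Qed.

(** As i and j are weakly on the same side of each chord, a point of the open
    segment from i to j lies on a chord only if i and j are its ends. So this
    segment meets no other chord of G inside the disk, and maximality applies. *)
Lemma tile_vertices_joined G z i j :
  generalized_dissection theta G -> off_chords G z ->
  (i < j)%N -> tile_around G z (pt theta i) -> tile_around G z (pt theta j) ->
  [set i; j]%SET \in G \/ consecutive [set i; j]%SET.
Proof.
move=> [[permG ncG crG] maxG] [dz oz] ij /tile_aroundP[_ ti] /tile_aroundP[_ tj].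
case: (pselect (consecutive [set i; j]%SET)) => [|nc]; [by right|left].
have pij := pt_neq ij.
have disj h : h \in G -> [set i; j]%SET <> h ->
    chord theta [set i; j]%SET `&` chord theta h `&` @open_disk R = set0.
  move=> hG ne; apply/seteqP; split=> // w [[]].
  have [d [e [de hE]]] := permissible_lt (permG h hG).
  rewrite {}hE in hG ne *.
  rewrite !chordE // => -[dw /= ow] [_ /= sw] odw.
  have [t /andP[t0 t1] wE] := line_disk_segpt (pt_norm _) (pt_norm _) pij dw ow.
  have t0' : 0 < t.
    rewrite lt_neqAle t0 andbT; apply/eqP => E.
    by move: odw; rewrite wE -E segpt_0 /open_disk /= pt_norm ltxx.
  have t1' : 0 < 1 - t.
    rewrite subr_gt0 lt_neqAle t1 andbT; apply/eqP => E.
    by move: odw; rewrite wE E segpt_1 /open_disk /= pt_norm ltxx.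
  move: sw; rewrite wE orient_segpt => sw.
  have := oz _ _ de hG; have := ti _ _ de hG; have := tj _ _ de hG.
  move: sw; have := @side_eq0 d e j de; have := @side_eq0 d e i de.
  move: (side d e (pt theta i)) (side d e (pt theta j)) (side d e z).
  move=> x y s hx hy sw ys xs s0.
  have s2 : 0 < s * s by rewrite -expr2 exprn_even_gt0.
  have E : (1 - t) * (x * s) + t * (y * s) = 0.
    by transitivity (((1 - t) * x + t * y) * s); [ring|rewrite sw mul0r].
  have : (1 - t) * (x * s) = 0 /\ t * (y * s) = 0.
    have h1 : 0 <= (1 - t) * (x * s) by rewrite mulr_ge0 // ltW.
    have h2 : 0 <= t * (y * s) by rewrite mulr_ge0.
    by split; lra.
  move=> -[] /eqP + /eqP.
  rewrite !mulf_eq0 (gt_eqF t0') (gt_eqF t1') (negbTE s0) !orbF /=.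
  move=> /eqP/hx iE /eqP/hy jE; apply: ne.
  case: iE ij => ->; case: jE => -> //; rewrite ?ltnn // => ed.
  by move: (ltn_trans de ed); rewrite ltnn.
have GE : ([set i; j]%SET |: G)%SET = G.
  apply: maxG; last exact: finset.subsetUr.
  split=> [g|g|g h].
  - rewrite !inE => /orP[/eqP->|]; last exact: permG.
    by rewrite /permissible cards2 -val_eqE /= neq_ltn ij.
  - rewrite !inE => /orP[/eqP->|]; last exact: ncG.
    by move/homotopic_to_boundaryE.
  - rewrite !inE => /orP[/eqP->|gG] /orP[/eqP->|hG] //.
    + exact: disj.
    + by move=> ne; rewrite (setIC (chord _ _)); apply: disj => // /esym.
    + exact: crG.
by rewrite -GE finset.setU11.
Qed.

(** The chord {a, c} would separate b from d. *)
Lemma no_four_vertices G z a b c d :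
  generalized_dissection theta G -> off_chords G z ->
  (a < b < c)%N -> (c < d)%N ->
  tile_around G z (pt theta a) -> tile_around G z (pt theta b) ->
  tile_around G z (pt theta c) -> ~ tile_around G z (pt theta d).
Proof.
move=> hG oz abc cd ta tb tc td; have /andP[ab bc] := abc.
have ac := ltn_trans ab bc.
have [acG|] := tile_vertices_joined hG oz ac ta tc; last first.
  by move/(consecutiveE ac); have := ltn_ord d; lia.
move: tb td => /tile_aroundP[_ /(_ _ _ ac acG)] hb /tile_aroundP[_ /(_ _ _ ac acG)] hd.
have := oz.2 _ _ ac acG.
have sb : side a c (pt theta b) < 0 by exact: side_inside.
have sd : 0 < side a c (pt theta d) by apply: side_outside; rewrite // cd orbT.
move: hb hd; rewrite nmulr_rge0 // pmulr_rge0 // => h1 h2.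
by rewrite eq_le h1 h2.
Qed.

Lemma chord_sub_tile G z i j : (i < j)%N ->
  tile_around G z (pt theta i) -> tile_around G z (pt theta j) ->
  chord theta [set i; j]%SET `<=` tile_around G z.
Proof.
move=> ij /tile_aroundP[_ ti] /tile_aroundP[_ tj] w; rewrite chordE // => -[dw ow].
have pij := pt_neq ij.
have [t /andP[t0 t1] wE] := line_disk_segpt (pt_norm _) (pt_norm _) pij dw ow.
apply/tile_aroundP; split=> // d e de deG.
rewrite wE orient_segpt mulrDl -!mulrA addr_ge0 // mulr_ge0 ?subr_ge0 //.
- exact: ti.
- exact: tj.
Qed.

(** For each chord one end of the arc is off the chord, hence strictly on the
    side of z, and the arc follows it. *)
Lemma boundary_segment_sub_tile G z k :
  partial_generalized_dissection theta G -> off_chords G z ->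
  tile_around G z (pt theta k) -> tile_around G z (pt theta (ordS k)) ->
  boundary_segment theta k `<=` tile_around G z.
Proof.
move=> [_ ncG _] [dz oz] tk tSk w [t /=]; rewrite in_itv /= => /andP[t0 t1] <-.
apply/tile_aroundP; split=> [|d e de deG]; first exact: circ_disk.
have nc : ~ consecutive [set d; e]%SET.
  by move=> h; apply: (ncG _ deG); apply/homotopic_to_boundaryE.
set phi := (1 - t) * theta k + t * next_angle theta k.
have kphi : theta k <= phi <= next_angle theta k.
  have := le_next_angle k; rewrite /phi; move: (theta k) (next_angle _ _) => x y xy.
  by apply/andP; split; nra.
have [i ik [i0]] := arc_side de nc kphi.
have : 0 <= side d e (pt theta i) * side d e z.
  move: ik; rewrite !inE => /orP[]/eqP->.
    by move/tile_aroundP: tk => -[_]; exact.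
  by move/tile_aroundP: tSk => -[_]; exact.
have := oz _ _ de deG.
rewrite /arc_path -/phi in i0 *.
move: i0; move: (side d e (pt theta i)) (side d e (circ phi)) (side d e z).
move=> x y s x0 s0 xs yx.
have xs0 : 0 < x * s by rewrite lt_neqAle eq_sym mulf_neq0.
have x2 : 0 < x * x by rewrite -expr2 exprn_even_gt0.
rewrite -(pmulr_rge0 _ x2) (_ : x * x * (y * s) = (y * x) * (x * s)); last by ring.
by rewrite mulr_ge0 // ltW.
Qed.

End Tiles.

Theorem lemma3p4 (R : realType) (n : nat) (hn : (1 <= n)%N)
  (theta : 'I_n.+3 -> R) (htheta : ccw_angles theta)
  (G : {set {set 'I_n.+3}}) (hG : generalized_dissection theta G) :
  forall T : set (R * R), is_tile theta G T -> is_triangle theta G T.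
Proof.
move=> T tT; have [[permG ncG crG] _] := hG.
have [z oz {tT}TE] := is_tileE htheta permG tT.
have [a [c [b [acb]]]] := tile_has_three_vertices htheta hG.1 oz.
rewrite -TE => ta tc tb; have /andP[ac cb] := acb.
have ab := ltn_trans ac cb.
have no4 := no_four_vertices htheta hG oz; rewrite -TE in no4.
have vert i : T (pt theta i) <-> i \in [set a; c; b]%SET.
  split; last by rewrite !inE -orbA => /or3P[]/eqP->.
  move=> ti; rewrite !inE -!val_eqE /=.
  case: (ltngtP i a) => //= ia; first by case: (no4 i a c b); rewrite ?ia.
  case: (ltngtP i c) => //= ic; first by case: (no4 a i c b); rewrite ?ia.
  case: (ltngtP i b) => //= ib; first by case: (no4 a c i b); rewrite ?ac.
  by case: (no4 a c b i).
have two_vertices (i j : 'I_n.+3) : i != j -> T (pt theta i) -> T (pt theta j) ->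
    [set i; j]%SET \in [set [set a; c]; [set c; b]; [set a; b]]%SET.
  move=> ij /vert + /vert; move: ij; rewrite !inE -!orbA.
  move=> ij /or3P[]/eqP iE /or3P[]/eqP jE; move: ij; rewrite iE jE ?eqxx // => _;
    by rewrite ?eqxx ?orbT // finset.setUC ?eqxx ?orbT.
have joined (i j : 'I_n.+3) : (i < j)%N -> T (pt theta i) -> T (pt theta j) ->
    [set i; j]%SET \in tile_edges theta G T.
  move=> ij; rewrite TE => ti tj; rewrite !inE.
  have [ijG|[k E]] := tile_vertices_joined htheta hG oz ij ti tj.
    by rewrite ijG asboolT //; exact: chord_sub_tile.
  apply/orP; right; rewrite E; apply: imset_f; rewrite !inE.
  apply: boundary_segment_sub_tile hG.1 oz _ _ => //.
    have : k \in [set i; j]%SET by rewrite E set21.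
    by rewrite !inE => /orP[]/eqP->.
  have : ordS k \in [set i; j]%SET by rewrite E set22.
  by rewrite !inE => /orP[]/eqP->.
exists a, c, b; split.
- by rewrite /= !inE -!val_eqE /= !ltn_eqF.
- by apply/finset.setP => i; rewrite inE; apply/asboolP/idP => /vert.
apply/finset.setP => g; apply/idP/idP.
  rewrite inE => /orP[].
    rewrite inE => /andP[gG /asboolP gT].
    have [d [e [de gE]]] := permissible_lt (permG g gG).
    rewrite {}gE in gG gT *; apply: two_vertices; first by rewrite -val_eqE neq_ltn de.
      by apply: gT; rewrite chordE //; split; [exact: pt_disk|exact: orientl].
    by apply: gT; rewrite chordE //; split; [exact: pt_disk|exact: orientr].
  move=> /imsetP[k + ->]; rewrite inE => /asboolP kT; apply: two_vertices.
  - rewrite -val_eqE; apply/eqP; change (nat_of_ord k <> ordS k).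
    by rewrite ordSE; case: eqP => [->|_] /=; lia.
  - by rewrite -arc_path0; apply: kT; exists 0; rewrite //= in_itv /= lexx ler01.
  - by rewrite -arc_path1; apply: kT; exists 1; rewrite //= in_itv /= lexx ler01.
move=> gabc.
have : [|| g == [set a; c], g == [set c; b] | g == [set a; b]]%SET.
  by move: gabc; rewrite !inE -orbA.
by move=> /or3P[]/eqP->; apply: joined.
Qed.
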